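(* Consider the stochastic wave equation on the sphere $\partial_{tt}u(t)-\Delta_{\mathbb S^2}u(t)=\dot L(t)$ with initial values $(u(0),\partial_t u(0))=(v_1,v_2)\in[L^2(\mathbb S^2,\mathbb R)]^2$. Assume that the expected initial energy satisfies $\mathbb E[\mathcal E(0)]<\infty$ and that the mean-zero $Q$-Lévy process $L$ is trace-class. Furthermore, assume $0<\mathbb E[\mathcal E_0^\kappa]$. Let $(u_{1,n}^\kappa,u_{2,n}^\kappa)$ be the fully discrete approximation given by the backward Euler--Maruyama scheme with time step $\tau>0$. Then the energy of this fully discrete approximation grows at a slower rate than that of the exact solution to the equation: $$\mathbb E[\mathcal E_n^\kappa]<\mathbb E[\mathcal E_0^\kappa]+\frac1{2\tau}\operatorname{Tr}(Q^\kappa)+\frac{t_n}2v_{0,0}$$ for every discrete time $t_n=n\tau$ with integer $n\ge0$, where $v_{0,0}=\operatorname{Var}(L_{0,0}(1))$. Moreover, $$\lim_{t_n\to\infty}\frac{\mathbb E[\mathcal E_n^\kappa]}{t_n}=\frac12v_{0,0}.$$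
   Context: $\mathbb S^2\subset\mathbb R^3$ is the unit sphere with its surface measure, $L^2(\mathbb S^2)=L^2(\mathbb S^2,\mathbb R)$ with inner product $\langle\cdot,\cdot\rangle$ and norm $\|\cdot\|$, and $\Delta_{\mathbb S^2}$ is the Laplace--Beltrami operator. The real spherical harmonics $(Y_{\ell,m})_{\ell\ge0,\,-\ell\le m\le\ell}$ form an orthonormal basis of $L^2(\mathbb S^2)$ with $-\Delta_{\mathbb S^2}Y_{\ell,m}=\lambda_\ell Y_{\ell,m}$, $\lambda_\ell=\ell(\ell+1)$. The initial energy is $\mathcal E(0)=\frac12\left(\|v_2\|^2+\|(-\Delta_{\mathbb S^2})^{1/2}v_1\|^2\right)$. $(\Omega,\mathcal F,(\mathcal F_t)_{t\ge0},\mathbb P)$ is a complete filtered probability space; $v_1,v_2$ are $\mathcal F_0$-measurable (possibly random). $L$ is a square-integrable $L^2(\mathbb S^2)$-valued Lévy process with respect to $(\mathcal F_t)$ (adapted, $L(0)=0$, stochastically continuous, stationary increments, $L(t)-L(s)$ independent of $\mathcal F_s$ for $s\le t$), with $\mathbb E[L(t)]=0$ and covariance operator $Q$ (symmetric, positive semi-definite): $\mathbb E[\langle L(t),f\rangle\langle L(t),g\rangle]=t\langle Qf,g\rangle$. ''Trace-class'' means $\operatorname{Tr}(Q)=\sum_{\ell,m}\langle QY_{\ell,m},Y_{\ell,m}\rangle<\infty$. Set $L_{\ell,m}=\langle L,Y_{\ell,m}\rangle$. For the exact solution, with energy $\mathcal E(t)=\frac12\left(\|\partial_tu(t)\|^2+\|(-\Delta_{\mathbb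 S^2})^{1/2}u(t)\|^2\right)$, the expected energy is $\mathbb E[\mathcal E(t)]=\mathbb E[\mathcal E(0)]+\frac t2\operatorname{Tr}(Q)$. For an integer $\kappa>0$, $\mathcal P_\kappa$ is the orthogonal projection of $L^2(\mathbb S^2)$ onto $H^\kappa=\operatorname{span}\{Y_{\ell,m}:0\le\ell\le\kappa,\,-\ell\le m\le\ell\}$, $\Delta^\kappa_{\mathbb S^2}$ is the restriction of $\Delta_{\mathbb S^2}$ to $H^\kappa$, and $Q^\kappa=\mathcal P_\kappa Q\mathcal P_\kappa$. With $t_n=n\tau$ and $\Delta L_n=L(t_{n+1})-L(t_n)$, the backward Euler--Maruyama scheme is given implicitly by $$u_{1,n+1}^\kappa=u_{1,n}^\kappa+\tau u_{2,n+1}^\kappa,\qquad u_{2,n+1}^\kappa=u_{2,n}^\kappa+\tau\Delta^\kappa_{\mathbb S^2}u_{1,n+1}^\kappa+\mathcal P_\kappa\Delta L_n,$$ started at $(u_{1,0}^\kappa,u_{2,0}^\kappa)=(\mathcal P_\kappa v_1,\mathcal P_\kappa v_2)$. Its energy is $\mathcal E_n^\kappa=\frac12\left(\|u_{2,n}^\kappa\|^2+\|(-\Delta^\kappa_{\mathbb S^2})^{1/2}u_{1,n}^\kappa\|^2\right)$. In the limit, $\tau$ and $\kappa$ are fixed and $n\to\infty$.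
   Formalization: The strict inequality fails e.g. for L=0, n=0; it is proved with ≤ for all n≥0, and strictly when Tr(Q^κ)>0, or when n≥1 and E[⟨v_2,Y_{0,0}⟩²/2] < E[E_0^κ]. This is exactly when it is true; the limit is unconditional. *)

(* Defs.v *)
From HB Require Import structures.
From mathcomp Require Import all_boot all_order all_algebra.
From mathcomp Require Import all_classical all_reals all_analysis.
From mathcomp Require Import measurable_realfun.

Set Implicit Arguments.
Unset Strict Implicit.
Unset Printing Implicit Defensive.
Import Order.TTheory GRing.Theory Num.Theory.
Import numFieldNormedType.Exports.

Local Open Scope classical_set_scope.
Local Open Scope ring_scope.

Section sphere.
Context {R : realType}.

(* The library norm on ['rV[R]_3] is the max-norm, hence an explicit Euclidean
   norm. *)
Definition enorm (x : 'rV[R]_3) : R := Num.sqrt (\sum_i x 0 i ^+ 2).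

Definition e3 (i : 'I_3) : 'rV[R]_3 := delta_mx 0 i.

Lemma enorm_e3 i : enorm (e3 i) == 1.
Proof.
apply/eqP; rewrite /enorm (bigD1 i)//= big1 ?addr0.
  by rewrite mxE !eqxx expr1n sqrtr1.
by move=> j /negbTE ji; rewrite mxE ji andbF expr0n.
Qed.

End sphere.

Definition sphere (R : realType) : Type := {x : 'rV[R]_3 | enorm x == 1}.
HB.instance Definition _ (R : realType) := SubChoice.on (sphere R).

Section sphere_measurable.
Context {R : realType}.

Definition north_pole : sphere R := exist _ (e3 2) (enorm_e3 2).
HB.instance Definition _ := isPointed.Build (sphere R) north_pole.

Definition sphere_coord (i : 'I_3) (p : sphere R) : R :=
  (val p) 0 i.

Let sphere_set0 : g_sigma_preimage sphere_coord set0.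
Proof. exact: sigma_algebra0. Qed.

Let sphere_setC A :
  g_sigma_preimage sphere_coord A -> g_sigma_preimage sphere_coord (~` A).
Proof. exact: sigma_algebraC. Qed.

Let sphere_bigcup (F : _^nat) :
  (forall i, g_sigma_preimage sphere_coord (F i)) ->
  g_sigma_preimage sphere_coord (\bigcup_i (F i)).
Proof. exact: sigma_algebra_bigcup. Qed.

(* The sigma-algebra generated by the three coordinate functions is the Borel
   sigma-algebra of the sphere. *)
HB.instance Definition _ := @isMeasurable.Build default_measure_display
  (sphere R) (g_sigma_preimage sphere_coord)
  sphere_set0 sphere_setC sphere_bigcup.

(* Junk value at the origin. *)
Definition sphere_proj (x : 'rV[R]_3) : sphere R :=
  insubd north_pole ((enorm x)^-1 *: x).

Definition row3 (a b c : R) : 'rV[R]_3 := a *: e3 0 + b *: e3 1 + c *: e3 2.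

Definition polar (a : R * R) : sphere R :=
  insubd north_pole
    (row3 (sin a.1 * cos a.2) (sin a.1 * sin a.2) (cos a.1)).

Lemma val_polar a : val (polar a) =
  row3 (sin a.1 * cos a.2) (sin a.1 * sin a.2) (cos a.1).
Proof.
rewrite /polar insubdK// unfold_in /enorm !big_ord_recl big_ord0 addr0 !mxE/=.
rewrite !(mulr1, mulr0, addr0, add0r) !exprMn addrA -mulrDr cos2Dsin2 mulr1.
by rewrite addrC cos2Dsin2 sqrtr1.
Qed.

Lemma measurable_polar : measurable_fun [set: _] polar.
Proof.
have coord i : measurable_fun [set: _] (sphere_coord i \o polar).
  have -> : sphere_coord i \o polar = fun a =>
      (row3 (sin a.1 * cos a.2) (sin a.1 * sin a.2) (cos a.1)) 0 i.
    by apply/funext => a; rewrite /sphere_coord/= val_polar.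
  have m1 (h : R -> R) : continuous h ->
      measurable_fun setT (fun a : R * R => h a.1).
    move=> ch; apply: (measurableT_comp (f := h)) => //.
    exact: continuous_measurable_fun.
  have m2 (h : R -> R) : continuous h ->
      measurable_fun setT (fun a : R * R => h a.2).
    move=> ch; apply: (measurableT_comp (f := h)) => //.
    exact: continuous_measurable_fun.
  rewrite [X in measurable_fun _ X](_ : _ = fun a =>
      sin a.1 * cos a.2 * e3 0 0 i + sin a.1 * sin a.2 * e3 1 0 i
      + cos a.1 * e3 2 0 i); last by apply/funext => a; rewrite !mxE.
  have [sn cn] := (@continuous_sin R, @continuous_cos R).
  by apply: measurable_funD; [apply: measurable_funD|];
    apply: measurable_funM => //; try apply: measurable_funM;
    [exact: m1|exact: m2|exact: m1|exact: m2|exact: m1].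
apply: (measurability (\big[setU/set0]_(i < 3)
  preimage_set_system setT (sphere_coord i) measurable)) => //.
move=> _ [A GA <-]; rewrite -bigcup_mkord_ord in GA.
case: GA => i Ii [B mB <-]; rewrite setTI.
have := coord (inord i) measurableT B mB.
by rewrite !setTI.
Qed.

Definition polar_domain : set (R * R) :=
  `[0, pi]%classic `*` `[0, 2 * pi]%classic.

Lemma measurable_polar_domain : measurable polar_domain.
Proof. by apply: measurableX; exact: measurable_itv. Qed.

(* Area formula for the parametrization [polar], of Jacobian [sin theta]. *)
Definition surface_measure (A : set (sphere R)) : \bar R :=
  (\int[@lebesgue_measure R \x @lebesgue_measure R]_(a in
     polar_domain `&` polar @^-1` A) (sin a.1)%:E)%E.

Let mpre (A : set (sphere R)) : measurable A ->
  measurable (polar_domain `&` polar @^-1` A).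
Proof.
move=> mA; apply: measurableI; first exact: measurable_polar_domain.
by rewrite -[X in measurable X]setTI; exact: measurable_polar.
Qed.

Let sin_ge0 (A : set (sphere R)) a :
  (polar_domain `&` polar @^-1` A) a -> (0 <= (sin a.1)%:E)%E.
Proof.
by move=> [[/= + _] _]; rewrite in_itv/= => a1; rewrite lee_fin sin_ge0_pi.
Qed.

Let surface_measure0 : surface_measure set0 = 0%E.
Proof. by rewrite /surface_measure preimage_set0 setI0 integral_set0. Qed.

Let surface_measure_ge0 A : (0 <= surface_measure A)%E.
Proof. by apply: integral_ge0 => a; exact: sin_ge0. Qed.

Let surface_measure_sigma_additive : semi_sigma_additive surface_measure.
Proof.
move=> F mF tF mUF; rewrite /surface_measure preimage_bigcup setI_bigcupr.
rewrite ge0_integral_bigcup//=.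
- apply: is_cvg_ereal_nneg_natsum_cond => n _ _.
  exact: surface_measure_ge0.
- by move=> k; exact: mpre.
- apply: (@measurable_funS _ _ _ _ setT) => //.
  apply/measurable_EFinP; apply: (measurableT_comp
    (f := sin : R -> R)) => //.
  by apply: continuous_measurable_fun; exact: continuous_sin.
- by move=> a [k _]; exact: sin_ge0.
- apply/trivIsetP => i j _ _ ij; rewrite setIACA setIid -preimage_setI.
  by move/trivIsetP : tF => ->//; rewrite preimage_set0 setI0.
Qed.

HB.instance Definition _ := isMeasure.Build _ _ _ surface_measure
  surface_measure0 surface_measure_ge0 surface_measure_sigma_additive.

End sphere_measurable.

(* The space L^2(S^2): its elements are represented by square-integrable
   functions, and equality in L^2 is equality almost everywhere, [l2eq]. *)
Notation L2_sphere R :=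
  (LfunType (@surface_measure R : {measure set (sphere R) -> \bar R})
            (lee1n 2)).

Section L2_sphere.
Context {R : realType}.
Implicit Types f g : L2_sphere R.

Definition l2eq (f g : sphere R -> R) : Prop := f = g %[ae @surface_measure R].

Definition l2dot f g : R := \int[@surface_measure R]_p (f p * g p).

Definition l2norm f : R := Num.sqrt (l2dot f f).

Definition l2open (U : set (L2_sphere R)) : Prop :=
  forall f, U f -> exists2 e : R, 0 < e & forall g, l2norm (g - f) < e -> U g.

Definition l2borel : set (set (L2_sphere R)) := <<s l2open >>.

End L2_sphere.

Section laplace_beltrami.
Context {R : realType}.
Implicit Types f : sphere R -> R.

Definition radial_ext f : 'rV[R]_3 -> R := f \o sphere_proj.

(* The Laplace-Beltrami operator of the round sphere is the Laplacian of the
   extension that is constant along rays. *)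
Definition laplace_beltrami f (p : sphere R) : R :=
  \sum_i 'D_(e3 i) ('D_(e3 i) (radial_ext f)) (val p).

Definition twice_cont_diff f : Prop :=
  forall (i j : 'I_3) (x : 'rV[R]_3), x != 0 ->
    [/\ derivable (radial_ext f) x (e3 i),
        derivable ('D_(e3 i) (radial_ext f)) x (e3 j) &
        {for x, continuous ('D_(e3 j) ('D_(e3 i) (radial_ext f)))}].

End laplace_beltrami.

(* The orders -l, ..., l. *)
Definition orders (l : nat) : seq int :=
  [seq i%:Z - l%:Z | i <- iota 0 (2 * l).+1].

Section spherical_harmonics.
Context {R : realType}.
Variable Y : nat -> int -> L2_sphere R.

Definition lambda (l : nat) : R := (l * l.+1)%:R.

Definition proj (kappa : nat) (f : L2_sphere R) : L2_sphere R :=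
  \sum_(l < kappa.+1) \sum_(m <- orders l) l2dot f (Y l m) *: Y l m.

(* Spherical harmonics of degree l are the eigenfunctions for the eigenvalue
   l(l+1); within a degree any orthonormal choice is allowed, in particular the
   usual real one. Only the indices with [m \in orders l] are meaningful. *)
Record spherical_harmonic_basis : Prop := {
  harmonic_smooth : forall l m, m \in orders l -> twice_cont_diff (Y l m);
  harmonic_eigen : forall l m, m \in orders l ->
    forall p, - laplace_beltrami (Y l m) p = lambda l * Y l m p;
  harmonic_orthonormal : forall l m l' m',
    m \in orders l -> m' \in orders l' ->
    l2dot (Y l m) (Y l' m') = ((l == l') && (m == m'))%:R;
  harmonic_total : forall f, l2norm (f - proj k f) @[k --> \oo] --> (0 : R)
}.

(* On the span of the harmonics of degree at most kappa, [proj kappa] is the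
   identity up to null sets; it selects the smooth representative to which
   [laplace_beltrami] applies. *)
Definition disc_laplacian (kappa : nat) (f : L2_sphere R) : sphere R -> R :=
  laplace_beltrami (proj kappa f).

Definition disc_half_laplacian (kappa : nat) (f : L2_sphere R) : L2_sphere R :=
  \sum_(l < kappa.+1) \sum_(m <- orders l)
    (Num.sqrt (lambda l) * l2dot f (Y l m)) *: Y l m.

(* The squared norm of (-Delta)^(1/2) f, infinite outside the domain. *)
Definition half_laplacian_sqnorm (f : L2_sphere R) : \bar R :=
  (\sum_(l <oo) (\sum_(m <- orders l) lambda l * l2dot f (Y l m) ^+ 2)%R%:E)%E.

Definition energy (u1 u2 : L2_sphere R) : \bar R :=
  ((2^-1)%:E * ((l2norm u2 ^+ 2)%:E + half_laplacian_sqnorm u1))%E.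

Definition disc_energy (kappa : nat) (u1 u2 : L2_sphere R) : R :=
  2^-1 * (l2norm u2 ^+ 2 + l2norm (disc_half_laplacian kappa u1) ^+ 2).

Definition trace (A : L2_sphere R -> L2_sphere R) : \bar R :=
  (\sum_(l <oo) (\sum_(m <- orders l) l2dot (A (Y l m)) (Y l m))%R%:E)%E.

Definition disc_operator (kappa : nat) (A : L2_sphere R -> L2_sphere R) :=
  fun f => proj kappa (A (proj kappa f)).

End spherical_harmonics.

Section levy.
Context {R : realType} {d : measure_display} {Omega : measurableType d}.
Variable P : probability Omega R.
Variable F : R -> set (set Omega).

Record complete_filtration : Prop := {
  filtration_sigma : forall t, 0 <= t -> sigma_algebra setT (F t);
  filtration_sub : forall t, 0 <= t -> F t `<=` measurable;
  filtration_le : forall s t, 0 <= s -> s <= t -> F s `<=` F t;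
  (* in particular P itself is complete *)
  filtration_complete : P.-negligible `<=` F 0
}.

Definition l2measurable (G : set (set Omega)) (X : Omega -> L2_sphere R) :=
  forall B, l2borel B -> G (X @^-1` B).

Variable L : R -> Omega -> L2_sphere R.

Definition incr (s t : R) (w : Omega) : L2_sphere R := L t w - L s w.

Record levy_process : Prop := {
  levy_adapted : forall t, 0 <= t -> l2measurable (F t) (L t);
  levy_init : {ae P, forall w, l2eq (L 0 w) (0 : L2_sphere R)};
  levy_continuous : forall t e : R, 0 <= t -> 0 < e ->
    P [set w | e < l2norm (L s w - L t w)]
      @[s --> within [set s | 0 <= s] (nbhs t)] --> 0%E;
  levy_stationary : forall s t h : R, 0 <= s -> 0 <= t -> 0 <= h ->
    forall B, l2borel B ->
    P (incr s (s + h) @^-1` B) = P (incr t (t + h) @^-1` B);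
  levy_independent : forall s t : R, 0 <= s -> s <= t ->
    forall A B, F s A -> l2borel B ->
    P (A `&` incr s t @^-1` B) = (P A * P (incr s t @^-1` B))%E
}.

Definition square_integrable_process : Prop :=
  forall t, 0 <= t -> (\int[P]_w (l2norm (L t w) ^+ 2)%:E < +oo)%E.

(* E[L(t)] = 0 for the L^2-valued (Bochner) expectation, which is determined by
   its inner products. *)
Definition mean_zero_process : Prop :=
  forall t (f : L2_sphere R), 0 <= t ->
    ('E_P[fun w => l2dot (L t w) f] = 0)%E.

Record covariance_operator (Q : L2_sphere R -> L2_sphere R) : Prop := {
  covariance_linear : forall (a : R) f g,
    l2eq (Q (a *: f + g)) (a *: Q f + Q g);
  covariance_sym : forall f g, l2dot (Q f) g = l2dot f (Q g);
  covariance_psd : forall f, 0 <= l2dot (Q f) f;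
  covariance_eq : forall t f g, 0 <= t ->
    ('E_P[(fun w => l2dot (L t w) f * l2dot (L t w) g)%R]
     = (t * l2dot (Q f) g)%R%:E)%E
}.

End levy.

Record backward_euler_maruyama {R : realType} {Omega : Type}
    (Y : nat -> int -> L2_sphere R) (L : R -> Omega -> L2_sphere R)
    (v1 v2 : Omega -> L2_sphere R) (kappa : nat) (tau : R)
    (u1 u2 : nat -> Omega -> L2_sphere R) : Prop := {
  bem_init1 : forall w, l2eq (u1 0%N w) (proj Y kappa (v1 w));
  bem_init2 : forall w, l2eq (u2 0%N w) (proj Y kappa (v2 w));
  bem_step1 : forall n w,
    l2eq (u1 n.+1 w) (fun p => u1 n w p + tau * u2 n.+1 w p);
  bem_step2 : forall n w,
    l2eq (u2 n.+1 w) (fun p => u2 n w p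
      + tau * disc_laplacian Y kappa (u1 n.+1 w) p
      + proj Y kappa (L (n.+1%:R * tau) w - L (n%:R * tau) w) p)
}.

(* Main.v *)
From HB Require Import structures.
Require Import Defs.
From mathcomp Require Import all_boot all_order all_algebra.
From mathcomp Require Import all_classical all_reals all_analysis.
From mathcomp Require Import measurable_realfun ring lra.
Import Order.TTheory GRing.Theory Num.Theory.
Import numFieldNormedType.Exports.

(** Project everything on one spherical harmonic [Y_i] of degree [l], with
    eigenvalue [lam = l (l + 1)].  The scheme becomes a scalar damped oscillator
    [a' = a + tau b'], [b' = b - tau lam a' + xi], and solving it for the new
    state gives, with [e = b ^ 2 + lam a ^ 2], the exact energy identity

      [e' = (e + 2 b xi + xi ^ 2) / (1 + tau ^ 2 lam)]      ([mode_energy_step]).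

    The increment [xi] of the Levy process is independent of the past, hence
    orthogonal to [b], and has second moment [tau q] with [q = <Q Y_i, Y_i>]
    ([incr_orthogonal], [incr_sqr]).  So the mean energy [eps n] of the mode obeys
    [eps n.+1 = (eps n + tau q) / (1 + tau ^ 2 lam)] ([mode_energy_mean]).

    For the constant harmonic [lam = 0] there is no damping and the mean energy is
    [eps 0 + n tau q].  For all other modes [lam > 1], and the recursion contracts
    towards its fixed point [q / (tau lam) <= q / tau]; so the mean energy is at
    most [eps 0 + q / tau], and less than that if the mode has noise, or has
    initial energy and at least one step was taken.  Half the sum over the modes up to
    [kappa] is the energy of the scheme, because its velocity stays in their span
    ([scheme_span]); the bounds add up to the claimed one, with
    [Tr Q^kappa] the sum of the [q] ([trace_disc_operator]), and after division by
    [n tau] only the linear growth of the constant mode survives. *)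

Set Implicit Arguments.
Unset Strict Implicit.
Unset Printing Implicit Defensive.

Local Open Scope classical_set_scope.
Local Open Scope ring_scope.

(** * The inner product of L2 of the sphere *)

Section inner_product.
Context {R : realType}.
Implicit Types f g h : L2_sphere R.
Local Notation mu := (@surface_measure R : {measure set (sphere R) -> \bar R}).

Lemma l2_integrableM f g : mu.-integrable setT (EFin \o (f \* g)).
Proof.
by apply/Lfun1_integrable; apply: Lfun2_mul_Lfun1; exact: LfunP.
Qed.

Lemma l2dotC f g : l2dot f g = l2dot g f.
Proof. by rewrite /l2dot; apply: eq_Rintegral => p _; rewrite mulrC. Qed.

Lemma l2dotDl f g h : l2dot (f + g) h = l2dot f h + l2dot g h.
Proof.
rewrite /l2dot -RintegralD//; [|exact: l2_integrableM..].
by apply: eq_Rintegral => p _; rewrite -mulrDl.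
Qed.

Lemma l2dotZl a f h : l2dot (a *: f) h = a * l2dot f h.
Proof.
rewrite /l2dot -RintegralZl//; last exact: l2_integrableM.
by apply: eq_Rintegral => p _; rewrite mulrA.
Qed.

Lemma l2dotBl f g h : l2dot (f - g) h = l2dot f h - l2dot g h.
Proof. by rewrite l2dotDl -scaleN1r l2dotZl mulN1r. Qed.

Lemma l2dot0l h : l2dot 0 h = 0.
Proof. by rewrite -(scale0r 0) l2dotZl mul0r. Qed.

Lemma l2dot_suml (I : Type) (s : seq I) (F : I -> L2_sphere R) h :
  l2dot (\sum_(i <- s) F i) h = \sum_(i <- s) l2dot (F i) h.
Proof.
by apply: (big_morph (fun f => l2dot f h)) => [f g|]; rewrite ?l2dotDl ?l2dot0l.
Qed.

Lemma l2dotZr a f h : l2dot h (a *: f) = a * l2dot h f.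
Proof. by rewrite l2dotC l2dotZl l2dotC. Qed.

Lemma l2dotBr f g h : l2dot h (f - g) = l2dot h f - l2dot h g.
Proof. by rewrite l2dotC l2dotBl !(l2dotC h). Qed.

Lemma l2dot_sqr_ge0 f : 0 <= l2dot f f.
Proof. by apply: Rintegral_ge0 => p _; rewrite -expr2 sqr_ge0. Qed.

Lemma sqr_l2norm f : l2norm f ^+ 2 = l2dot f f.
Proof. by rewrite /l2norm sqr_sqrtr// l2dot_sqr_ge0. Qed.

Lemma l2dot_l2eq f g h : l2eq f g -> l2dot f h = l2dot g h.
Proof.
move=> fg; rewrite /l2dot /Rintegral; congr fine; apply: ae_eq_integral => //.
- by apply/measurable_EFinP; exact: measurable_funM.
- by apply/measurable_EFinP; exact: measurable_funM.
- by apply: filterS fg => p /(_ I) -> _.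
Qed.

(** Bessel's inequality for one unit vector: expand the square norm of
    [f - <f, h> h]. *)
Lemma l2dot_sqr_le f h : l2dot h h = 1 -> l2dot f h ^+ 2 <= l2dot f f.
Proof.
move=> h1; have := l2dot_sqr_ge0 (f - l2dot f h *: h).
rewrite l2dotBl !l2dotBr !l2dotZl !l2dotZr h1 (l2dotC h f) => H.
by rewrite -subr_ge0; apply: le_trans H _; rewrite expr2 mulr1 subrr subr0.
Qed.

(** Coordinates along a unit vector are continuous, hence Borel, functions on
    [L2]; this transports measurability and independence from [L2]-valued random
    elements to their coordinates. *)
Lemma l2borel_l2dot h (B : set R) : l2dot h h = 1 -> measurable B ->
  l2borel [set f | B (l2dot f h)].
Proof.
move=> h1 mB; have {}mB : <<s @RGenOInfty.G R >> B.
  by rewrite -[X in X B]/(_.-sigma.-measurable) -RGenOInfty.measurableE.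
move: B mB.
apply: (smallest_sub (X := [set B | l2borel [set f | B (l2dot f h)]])).
  split=> [|A|A] /=.
  - exact: sigma_algebra0.
  - by move=> mA; exact: (sigma_algebraCD mA).
  - by move=> mA; exact: sigma_algebra_bigcup.
move=> _ [x ->]/=; apply: sub_sigma_algebra => f /=.
rewrite in_itv/= andbT => xf.
exists (l2dot f h - x); first by rewrite subr_gt0.
move=> g gf; rewrite in_itv/= andbT.
have /ler_normlW : `|l2dot (f - g) h| <= l2norm (g - f).
  rewrite -ler_sqr ?nnegrE ?normr_ge0 ?sqrtr_ge0// sqr_l2norm.
  rewrite real_normK ?num_real//.
  rewrite -(opprB g f) -scaleN1r l2dotZl mulN1r sqrrN.
  exact: l2dot_sqr_le.
by rewrite l2dotBl; lra.
Qed.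

End inner_product.

(** * Linearity of the Laplace-Beltrami operator *)

Section second_derivatives.
Context {K : numFieldType} {V W : normedModType K}.
Implicit Types F G : V -> W.

Lemma near_neq0 (x : V) : x != 0 -> \forall y \near x, y != 0.
Proof. exact: (cvgr_neq0 (f := id) x cvg_id). Qed.

Definition lincomb (a : K) F G (y : V) : W := a *: F y + G y.

Lemma derivable_lincomb F G (a : K) (x v : V) :
  derivable F x v -> derivable G x v ->
  derivable (lincomb a F G) x v.
Proof. by move=> dF dG; apply: derivableD => //; exact: derivableZ. Qed.

Lemma derive_lincomb F G (a : K) (x v : V) :
  derivable F x v -> derivable G x v ->
  'D_v (lincomb a F G) x = a *: 'D_v F x + 'D_v G x.
Proof.
move=> dF dG; have daF : derivable (a \*: F) x v by exact: derivableZ.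
by rewrite (deriveD daF dG) deriveZ.
Qed.

(** The origin is left out because radial extensions are constant along rays and
    so, in general, discontinuous there. *)
Definition C2_off0 (v w : V) F : Prop := forall x, x != 0 ->
  [/\ derivable F x v, derivable ('D_v F) x w &
      {for x, continuous ('D_w ('D_v F))}].

(** Away from the origin the first derivative of the combination agrees with the
    combination of the first derivatives on a whole neighbourhood, which is what
    the second derivative depends on. *)
Lemma derive2_lincomb F G (a : K) (v w : V) : C2_off0 v w F -> C2_off0 v w G ->
  forall x, x != 0 -> derivable ('D_v (lincomb a F G)) x w /\
  'D_w ('D_v (lincomb a F G)) x = lincomb a ('D_w ('D_v F)) ('D_w ('D_v G)) x.
Proof.
move=> sF sG x x0; have [_ ddF _] := sF x x0; have [_ ddG _] := sG x x0.
have near_D :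
    {near x, (lincomb a ('D_v F) ('D_v G)) =1 'D_v (lincomb a F G)}.
  apply: filterS (near_neq0 x0) => y y0.
  have [dF _ _] := sF y y0; have [dG _ _] := sG y y0.
  by rewrite [RHS]derive_lincomb.
split; first by apply: (near_eq_derivable near_D); exact: derivable_lincomb.
by rewrite -(near_eq_derive _ near_D); exact: derive_lincomb.
Qed.

Lemma C2_lincomb F G (a : K) (v w : V) :
  C2_off0 v w F -> C2_off0 v w G -> C2_off0 v w (lincomb a F G).
Proof.
move=> sF sG x x0; have [dF _ cF] := sF x x0; have [dG _ cG] := sG x x0.
have [ddH DDH] := derive2_lincomb a sF sG x0.
split; [exact: derivable_lincomb|exact: ddH|].
rewrite /prop_for /continuous_at DDH.
apply: cvg_trans (cvgD (cvgZ (cvg_cst a) cF) cG); apply: near_eq_cvg.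
apply: filterS (near_neq0 x0) => y y0.
by rewrite (derive2_lincomb a sF sG y0).2.
Qed.

Lemma derive_cst0 (v : V) : 'D_v (cst 0 : V -> W) = cst 0.
Proof. by apply/funext => x; exact: derive_cst. Qed.

Lemma C2_cst0 (v w : V) : C2_off0 v w (cst 0).
Proof.
move=> x _; rewrite derive_cst0; split; [exact: derivable_cst..|].
by rewrite derive_cst0; exact: cvg_cst.
Qed.

End second_derivatives.

Section laplacian.
Context {R : realType}.
Implicit Types f g : sphere R -> R.

Lemma sphere_neq0 (p : sphere R) : val p != 0.
Proof.
apply/eqP => p0; have := valP p; rewrite p0 /enorm big1 ?sqrtr0.
  by rewrite eq_sym oner_eq0.
by move=> i _; rewrite mxE expr0n.
Qed.

Lemma radial_ext_lincomb f g a :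
  radial_ext (fun p => a * f p + g p)
  = @lincomb R 'rV[R]_3 R a (radial_ext f) (radial_ext g).
Proof. by []. Qed.

Lemma twice_cont_diff_lincomb f g a :
  twice_cont_diff f -> twice_cont_diff g ->
  twice_cont_diff (fun p => a * f p + g p).
Proof.
move=> sf sg i j; rewrite radial_ext_lincomb.
exact: (C2_lincomb a (sf i j) (sg i j)).
Qed.

Lemma laplace_beltrami_lincomb f g a p :
  twice_cont_diff f -> twice_cont_diff g ->
  laplace_beltrami (fun p => a * f p + g p) p
  = a * laplace_beltrami f p + laplace_beltrami g p.
Proof.
move=> sf sg; rewrite /laplace_beltrami mulr_sumr -big_split/=.
apply: eq_bigr => i _; rewrite radial_ext_lincomb.
by have [_ ->] := derive2_lincomb a (sf i i) (sg i i) (sphere_neq0 p).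
Qed.

Lemma radial_ext0 : radial_ext (fun=> 0) = (@cst 'rV[R]_3 R 0).
Proof. by []. Qed.

Lemma twice_cont_diff0 : twice_cont_diff (fun=> 0 : R).
Proof. by move=> i j; rewrite radial_ext0; exact: C2_cst0. Qed.

Lemma laplace_beltrami0 p : laplace_beltrami (fun=> 0 : R) p = 0.
Proof.
rewrite /laplace_beltrami big1// => i _.
by rewrite radial_ext0 derive_cst0 derive_cst.
Qed.

(** The induction carries the smoothness of the partial sums along, since a
    derivative is only additive on differentiable functions. *)
Lemma laplace_beltrami_sum (I : eqType) (s : seq I) (c : I -> R)
    (f : I -> sphere R -> R) (p : sphere R) :
  (forall i, i \in s -> twice_cont_diff (f i)) ->
  laplace_beltrami (fun q => \sum_(i <- s) c i * f i q) p
  = \sum_(i <- s) c i * laplace_beltrami (f i) p.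
Proof.
move=> sf; pose S s := fun q => \sum_(i <- s) c i * f i q.
suff H : laplace_beltrami (S s) p
    = \sum_(i <- s) c i * laplace_beltrami (f i) p /\ twice_cont_diff (S s).
  exact: H.1.
elim: s sf => [_|i s IH sf].
  have -> : S [::] = fun=> 0 by apply/funext => q; rewrite /S big_nil.
  by rewrite big_nil laplace_beltrami0; split=> //; exact: twice_cont_diff0.
have -> : S (i :: s) = fun q => c i * f i q + S s q.
  by apply/funext => q; rewrite /S big_cons.
have [|IHs ts] := IH; first by move=> j js; apply: sf; rewrite inE js orbT.
have ti : twice_cont_diff (f i) by apply: sf; rewrite mem_head.
split; last exact: (twice_cont_diff_lincomb (c i) ti ts).
by rewrite big_cons -IHs; exact: (laplace_beltrami_lincomb (c i) p ti ts).
Qed.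

End laplacian.

(** * Coordinates in spherical harmonics *)

Definition modes (kappa : nat) : seq (nat * int) :=
  [seq (l, m) | l <- iota 0 kappa.+1, m <- orders l].
Arguments modes : simpl never.

Lemma sum_modes (V : nmodType) (kappa : nat) (F : nat -> int -> V) :
  \sum_(l < kappa.+1) \sum_(m <- orders l) F l m
  = \sum_(i <- modes kappa) F i.1 i.2.
Proof.
rewrite big_allpairs_dep.
by rewrite -(big_mkord xpredT (fun l => \sum_(m <- orders l) F l m)).
Qed.

Lemma mem_modes kappa i :
  (i \in modes kappa) = (i.1 <= kappa)%N && (i.2 \in orders i.1).
Proof.
case: i => l m; rewrite /fst/snd; apply/allpairsPdep/andP.
  by move=> [l' [m' [+ m'l' [-> ->]]]]; rewrite mem_iota ltnS.
by move=> [lk ml]; exists l, m; rewrite mem_iota ltnS.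
Qed.

Lemma uniq_orders l : uniq (orders l).
Proof. by rewrite map_inj_uniq ?iota_uniq// => i j /addIr []. Qed.

Lemma uniq_modes kappa : uniq (modes kappa).
Proof.
apply: allpairs_uniq_dep => [|l _|]; first exact: iota_uniq.
  exact: uniq_orders.
by move=> [l m] [l' m'] _ _ /= [-> ->].
Qed.

Lemma lambda0 (R : realType) : lambda 0 = 0 :> R.
Proof. by rewrite /lambda. Qed.

Lemma lambda_ge0 (R : realType) l : 0 <= lambda l :> R.
Proof. by rewrite /lambda. Qed.

Lemma lambda_gt1 (R : realType) l : (0 < l)%N -> 1 < lambda l :> R.
Proof.
move=> l0; by rewrite /lambda ltr1n; case: l l0.
Qed.

Section harmonics.
Context {R : realType}.
Variable Y : nat -> int -> L2_sphere R.
Hypothesis hY : spherical_harmonic_basis Y.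
Implicit Types f g : L2_sphere R.

Definition coef f (i : nat * int) : R := l2dot f (Y i.1 i.2).

Definition synth (kappa : nat) (c : nat * int -> R) : L2_sphere R :=
  \sum_(i <- modes kappa) c i *: Y i.1 i.2.

Lemma coef_l2eq f g i : l2eq f g -> coef f i = coef g i.
Proof. exact: l2dot_l2eq. Qed.

Lemma coef_add f g i : coef (f + g) i = coef f i + coef g i.
Proof. exact: l2dotDl. Qed.

Lemma coef_scale c f i : coef (c *: f) i = c * coef f i.
Proof. exact: l2dotZl. Qed.

Lemma sumL2E (I : Type) (s : seq I) (F : I -> L2_sphere R) p :
  (\sum_(i <- s) F i) p = \sum_(i <- s) F i p.
Proof. exact: (big_morph (fun f : L2_sphere R => f p)). Qed.

Lemma synthE kappa c p :
  synth kappa c p = \sum_(i <- modes kappa) c i * Y i.1 i.2 p.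
Proof. by rewrite /synth sumL2E. Qed.

Lemma projE kappa f : Defs.proj Y kappa f = synth kappa (coef f).
Proof. exact: (sum_modes kappa (fun l m => l2dot f (Y l m) *: Y l m)). Qed.

Lemma disc_half_laplacianE kappa f : disc_half_laplacian Y kappa f
  = synth kappa (fun i => Num.sqrt (lambda i.1) * coef f i).
Proof.
exact: (sum_modes kappa
  (fun l m => (Num.sqrt (lambda l) * l2dot f (Y l m)) *: Y l m)).
Qed.

(** The geometric Laplacian enters the scheme only through finite sums of
    harmonics, where it acts diagonally. *)
Lemma disc_laplacianE kappa f : disc_laplacian Y kappa f
  = synth kappa (fun i => - (lambda i.1 * coef f i)).
Proof.
apply/funext => p; rewrite synthE /disc_laplacian projE.
have -> : (synth kappa (coef f) : sphere R -> R)
    = (fun q => \sum_(i <- modes kappa) coef f i * Y i.1 i.2 q).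
  by apply/funext => q; rewrite synthE.
rewrite laplace_beltrami_sum => [|i]; last first.
  by rewrite mem_modes => /andP[_]; exact: harmonic_smooth.
rewrite [LHS]big_seq [RHS]big_seq; apply: eq_bigr => i.
rewrite mem_modes => /andP[_ im].
rewrite -[laplace_beltrami _ _]opprK (harmonic_eigen hY)//.
by rewrite mulrN mulrCA mulrA mulNr.
Qed.

Lemma l2dot_harmonic i : i.2 \in orders i.1 ->
  l2dot (Y i.1 i.2) (Y i.1 i.2) = 1.
Proof. by move=> im; rewrite (harmonic_orthonormal hY)// !eqxx. Qed.

Lemma coef_synth kappa c j : j.2 \in orders j.1 ->
  coef (synth kappa c) j = (j \in modes kappa)%:R * c j.
Proof.
move=> jm; rewrite /coef /synth l2dot_suml.
have Yij i : i \in modes kappa ->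
    l2dot (c i *: Y i.1 i.2) (Y j.1 j.2) = c i * (i == j)%:R.
  rewrite mem_modes => /andP[_ im].
  by rewrite l2dotZl (harmonic_orthonormal hY)//; case: i j {im jm} => ? ? [].
rewrite big_seq (eq_bigr _ Yij) -big_seq.
have [jk|jk] := boolP (j \in modes kappa).
  rewrite (bigD1_seq j) ?uniq_modes// eqxx mulr1 mul1r.
  rewrite big1 => [|i ij]; first exact: addr0.
  by rewrite (negbTE ij) mulr0.
rewrite mul0r big_seq big1// => i ik; case: eqP => [ij|]; rewrite ?mulr0//.
by rewrite ij (negbTE jk) in ik.
Qed.

Lemma coef_synth_in kappa c j : j \in modes kappa ->
  coef (synth kappa c) j = c j.
Proof.
by move=> jk; move: (jk); rewrite mem_modes => /andP[_ jm];
  rewrite coef_synth// jk mul1r.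
Qed.

Lemma sqr_l2norm_synth kappa c :
  l2norm (synth kappa c) ^+ 2 = \sum_(i <- modes kappa) c i ^+ 2.
Proof.
rewrite sqr_l2norm {1}/synth l2dot_suml; rewrite big_seq [RHS]big_seq.
apply: eq_bigr => i ik; rewrite l2dotZl l2dotC -/(coef _ _).
by rewrite coef_synth_in.
Qed.

Lemma sqr_l2norm_l2eq f g : l2eq f g -> l2norm f ^+ 2 = l2norm g ^+ 2.
Proof.
by move=> fg; rewrite !sqr_l2norm (l2dot_l2eq _ fg) l2dotC (l2dot_l2eq _ fg).
Qed.

(** Membership in the span up to null sets forces the coordinates, so the
    coefficients of an expansion never have to be tracked. *)
Lemma synth_coef kappa f c :
  l2eq f (synth kappa c) -> synth kappa (coef f) = synth kappa c.
Proof.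
move=> fc; rewrite /synth big_seq [RHS]big_seq.
by apply: eq_bigr => i ik; rewrite (coef_l2eq i fc) coef_synth_in.
Qed.

Lemma synth_lincomb kappa (c e : nat * int -> R) a :
  synth kappa (fun i => a * c i + e i) = a *: synth kappa c + synth kappa e.
Proof.
rewrite /synth scaler_sumr -big_split/=; apply: eq_bigr => i _.
by rewrite scalerDl scalerA.
Qed.

Lemma coef_proj kappa f i : i \in modes kappa ->
  coef (Defs.proj Y kappa f) i = coef f i.
Proof. by move=> ik; rewrite projE coef_synth_in. Qed.

(** Symmetry moves [Q] onto [proj kappa Y_i], which agrees with [Y_i] only up to a
    null set; so the diagonal of the compression is that of [Q] up to degree
    [kappa] and zero beyond, and the series reduces to a finite sum. *)
Lemma trace_disc_operator kappa (Q : L2_sphere R -> L2_sphere R) :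
  (forall f g, l2dot (Q f) g = l2dot f (Q g)) ->
  (forall f, 0 <= l2dot (Q f) f) ->
  trace Y (disc_operator Y kappa Q)
  = (\sum_(i <- modes kappa) coef (Q (Y i.1 i.2)) i)%:E.
Proof.
move=> symQ psdQ; rewrite /trace /disc_operator.
have diagE l m : (l <= kappa)%N -> m \in orders l ->
    l2dot (Defs.proj Y kappa (Q (Defs.proj Y kappa (Y l m)))) (Y l m)
    = l2dot (Q (Y l m)) (Y l m).
  move=> lk lm; have ik : (l, m) \in modes kappa by rewrite mem_modes lk.
  rewrite [LHS](coef_proj _ ik) /coef symQ projE /synth l2dot_suml.
  rewrite (bigD1_seq _ ik (uniq_modes _))/= big1_seq => [|[l' m']].
    by rewrite addr0 l2dotZl /coef (l2dot_harmonic (i := (l, m)))// mul1r symQ.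
  move=> /andP[ji]; rewrite mem_modes => /andP[_ jm].
  rewrite l2dotZl /coef (harmonic_orthonormal hY)//.
  by move: ji; rewrite xpair_eqE eq_sym (eq_sym m') => /negbTE->; rewrite mul0r.
have outE l m : m \in orders l -> (kappa < l)%N ->
    l2dot (Defs.proj Y kappa (Q (Defs.proj Y kappa (Y l m)))) (Y l m) = 0.
  move=> lm kl; set g := Q _; transitivity (coef (Defs.proj Y kappa g) (l, m)).
    by [].
  rewrite projE coef_synth// mem_modes/= leqNgt kl.
  by rewrite mul0r.
rewrite (nneseries_split 0 kappa.+1) => [|l _]; last first.
  rewrite lee_fin big_seq sumr_ge0// => m lm.
  have [lk|kl] := leqP l kappa.
    by rewrite diagE//; exact: psdQ.
  by rewrite outE.
rewrite [X in (_ + X)%E]eseries0 ?adde0 => [|l /= kl _]; last first.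
  by rewrite big_seq big1// => m lm; rewrite outE.
rewrite add0n big_mkord sumEFin; congr EFin.
transitivity (\sum_(l < kappa.+1) \sum_(m <- orders l)
  l2dot (Q (Y l m)) (Y l m)).
  apply: eq_bigr => l _; rewrite big_seq [RHS]big_seq; apply: eq_bigr => m lm.
  by rewrite diagE// -ltnS.
exact: (sum_modes kappa (fun l m => l2dot (Q (Y l m)) (Y l m))).
Qed.

End harmonics.

(** * Means, independence and adaptedness *)

Section independence.
Context {R : realType} {d : measure_display} {Omega : measurableType d}.
Variable P : probability Omega R.

Definition sqr_integrable (X : Omega -> R) : Prop :=
  P.-integrable setT (EFin \o (fun w => X w ^+ 2)).

(** Here the majorant is arbitrary: it will be the full initial energy, an
    infinite series of squared coordinates. *)
Lemma le_integral_ge0 (f g : Omega -> \bar R) :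
  (forall w, 0 <= f w)%E -> (forall w, f w <= g w)%E ->
  (\int[P]_w f w <= \int[P]_w g w)%E.
Proof.
move=> f0 fg; rewrite !ge0_integralTE// => [|w]; last exact: le_trans (fg w).
by apply: le_ereal_sup => _ [h hf <-]; exists h => // w; exact: le_trans (fg w).
Qed.

Lemma integrableM (X Z : Omega -> R) :
  measurable_fun setT X -> measurable_fun setT Z ->
  sqr_integrable X -> sqr_integrable Z ->
  P.-integrable setT (EFin \o (fun w => X w * Z w)).
Proof.
move=> mX mZ iX iZ; have := integrableD measurableT iX iZ.
apply: le_integrable => //.
  by apply/measurable_EFinP; exact: measurable_funM.
move=> w _ /=; rewrite lee_fin normrM [leRHS]ger0_norm ?addr_ge0 ?sqr_ge0//.
have := sqr_ge0 (`|X w| - `|Z w|); rewrite sqrrB !real_normK ?num_real//.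
by have := mulr_ge0 (normr_ge0 (X w)) (normr_ge0 (Z w)); lra.
Qed.

Lemma sqr_integrable_integrable (X : Omega -> R) : measurable_fun setT X ->
  sqr_integrable X -> P.-integrable setT (EFin \o X).
Proof.
move=> mX iX; rewrite (_ : X = fun w => 1 * X w); last first.
  by apply/funext => w; rewrite mul1r.
by apply: integrableM => //; exact: finite_measure_integrable_cst.
Qed.

(** The joint law is the product of the laws, since the two agree on rectangles;
    Fubini then integrates the centred factor first. *)
Lemma independent_expectationM0 (X Z : Omega -> R) :
  measurable_fun setT X -> measurable_fun setT Z ->
  (forall A B, measurable A -> measurable B ->
    P (X @^-1` A `&` Z @^-1` B) = (P (X @^-1` A) * P (Z @^-1` B))%E) ->
  sqr_integrable X -> sqr_integrable Z ->
  (\int[P]_w (Z w)%:E = 0)%E ->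
  (\int[P]_w (X w * Z w)%:E = 0)%E.
Proof.
move=> mX mZ indep iX iZ Z0.
pose X' : {RV P >-> R} := HB.pack X (isMeasurableFun.Build _ _ _ _ X mX).
pose Z' : {RV P >-> R} := HB.pack Z (isMeasurableFun.Build _ _ _ _ Z mZ).
pose J w := (X w, Z w).
have mJ : measurable_fun setT J by exact: measurable_fun_pair.
pose J' : {RV P >-> (R * R)%type} :=
  HB.pack J (isMeasurableFun.Build _ _ _ _ J mJ).
have iXZ := integrableM mX mZ iX iZ.
pose f (z : R * R) : \bar R := (z.1 * z.2)%:E.
have mf : measurable_fun setT f.
  by apply/measurable_EFinP; apply: measurable_funM.
have prodE := @product_measure_unique _ _ _ _ R (distribution P X')
  (distribution P Z') (distribution P J') indep.
have -> : (\int[P]_w (X w * Z w)%:E = \int[distribution P J']_z f z)%E.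
  by rewrite integral_distribution.
have intf : (distribution P J').-integrable setT f.
  exact: integrable_pushforward.
have <- : (\int[distribution P X' \x distribution P Z']_z f z
           = \int[distribution P J']_z f z)%E.
  by apply: eq_measure_integral => A mA _; exact: prodE.
have intf2 : (distribution P X' \x distribution P Z')%E.-integrable setT f.
  apply/integrableP; split => //.
  rewrite (eq_measure_integral (distribution P J')) => [|A mA _].
    by have /integrableP[] := intf.
  exact: prodE.
rewrite -(integral12_prod_meas1 intf2) /fubini_F /f/=.
rewrite integral0_eq // => x _.
have iZ1 : P.-integrable setT (EFin \o Z).
  exact: sqr_integrable_integrable.
under eq_integral do rewrite EFinM.
rewrite integralZl//; last exact: integrable_pushforward.
by rewrite integral_distribution//= Z0 mule0.
Qed.

(** Integrability and value in one predicate, since the energy recursion has to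
    carry both. *)
Definition has_mean (X : Omega -> R) (m : R) : Prop :=
  P.-integrable setT (EFin \o X) /\ (\int[P]_w (X w)%:E = m%:E)%E.

Lemma has_meanD X Z m n : has_mean X m -> has_mean Z n ->
  has_mean (fun w => X w + Z w) (m + n).
Proof.
move=> [iX EX] [iZ EZ]; split; first exact: (integrableD measurableT iX iZ).
by rewrite EFinD -EX -EZ -integralD_EFin.
Qed.

Lemma has_meanZ X m k : has_mean X m -> has_mean (fun w => k * X w) (k * m).
Proof.
move=> [iX EX]; split; first exact: (integrableZl measurableT k iX).
by rewrite EFinM -EX -integralZl.
Qed.

Lemma has_mean_sum (I : eqType) (s : seq I) (X : I -> Omega -> R) (m : I -> R) :
  (forall i, i \in s -> has_mean (X i) (m i)) ->
  has_mean (fun w => \sum_(i <- s) X i w) (\sum_(i <- s) m i).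
Proof.
elim: s => [_|i s IH sX].
  rewrite big_nil (_ : (fun _ => _) = cst 0); last first.
    by apply/funext => w; rewrite big_nil.
  by split; [exact: integrable0|rewrite integral0].
rewrite big_cons (_ : (fun _ => _) = fun w => X i w + \sum_(j <- s) X j w).
  apply: has_meanD; first by apply: sX; rewrite mem_head.
  by apply: IH => j js; apply: sX; rewrite inE js orbT.
by apply/funext => w; rewrite big_cons.
Qed.

Lemma has_mean_expectation X m : has_mean X m -> ('E_P[X] = m%:E)%E.
Proof. by move=> [_ EX]; rewrite unlock. Qed.

Definition adapted (G : set (set Omega)) (X : Omega -> R) : Prop :=
  forall B, measurable B -> G (X @^-1` B).

(** Adaptedness is measurability for the type carrying the sub-sigma-algebra, and
    inherits the closure properties of measurable functions from there. *)
Lemma adaptedP G X : sigma_algebra setT G ->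
  adapted G X <-> measurable_fun setT (X : g_sigma_algebraType G -> R).
Proof.
move=> sG; split=> [aX _ B mB|mX B mB].
  by rewrite setTI; apply: sub_sigma_algebra; exact: aX.
have := mX measurableT B mB; rewrite setTI.
by rewrite /measurable/= sigma_algebra_id.
Qed.

Lemma adapted_lincomb G X Z k l : sigma_algebra setT G ->
  adapted G X -> adapted G Z -> adapted G (fun w => k * X w + l * Z w).
Proof.
move=> sG /(adaptedP _ sG) aX /(adaptedP _ sG) aZ; apply/(adaptedP _ sG).
by apply: measurable_funD; exact: measurable_funM.
Qed.

Lemma adapted_measurable G X : G `<=` measurable -> adapted G X ->
  measurable_fun setT X.
Proof. by move=> Gm aX _ B mB; rewrite setTI; apply: Gm; exact: aX. Qed.

End independence.

(** * The scalar recursion for the mean energy of one mode *)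

Lemma cvg_inv_time {R : realType} (c tau : R) :
  c * (n%:R * tau)^-1 @[n --> \oo] --> (0 : R).
Proof.
rewrite -(mulr0 c); apply: cvgMl_tmp; rewrite -(mul0r tau^-1).
under eq_fun do rewrite invfM.
by apply: cvgMr_tmp; rewrite -cvg_shiftS; exact: cvg_harmonic.
Qed.

Section mean_energy_sequence.
Context {R : realType}.

Definition mean_energy (tau lam q e0 : R) (n : nat) : R :=
  iter n (fun e => (e + tau * q) / (1 + tau ^+ 2 * lam)) e0.

Variables (tau q e0 : R).
Hypotheses (tau0 : 0 < tau) (q0 : 0 <= q) (e00 : 0 <= e0).

Lemma mean_energy0 n : mean_energy tau 0 q e0 n = e0 + n%:R * tau * q.
Proof.
elim: n => [|n IH]; first by rewrite /mean_energy/= !mul0r addr0.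
by rewrite /mean_energy iterS -/(mean_energy _ _ _ _ _) IH mulr0 addr0 divr1
  -natr1; ring.
Qed.

Variable lam : R.
Hypothesis lam1 : 1 < lam.
Let r := (1 + tau ^+ 2 * lam)^-1.
(* The fixed point of the recursion. *)
Let c := q / (tau * lam).

Let t2l_gt0 : 0 < tau ^+ 2 * lam.
Proof. by rewrite mulr_gt0 ?exprn_gt0// (lt_trans ltr01). Qed.

Let r_gt0 : 0 < r.
Proof. by rewrite invr_gt0 addr_gt0. Qed.

Let r_lt1 : r < 1.
Proof. by rewrite invf_lt1 ?addr_gt0// ltrDl. Qed.

(** An affine contraction: the distance to its fixed point decays like [r ^ n]. *)
Lemma mean_energyE n : mean_energy tau lam q e0 n = r ^+ n * (e0 - c) + c.
Proof.
elim: n => [|n IH]; first by rewrite /mean_energy/= expr0 mul1r subrK.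
rewrite /mean_energy iterS -/(mean_energy _ _ _ _ _) IH -/r [r ^+ n.+1]exprS.
have cE : (c + tau * q) * r = c.
  have l_neq0 : lam != 0 by rewrite gt_eqF// (lt_trans ltr01).
  have d_neq0 : 1 + tau ^+ 2 * lam != 0 by rewrite gt_eqF// addr_gt0.
  by rewrite /c /r; field; rewrite d_neq0 l_neq0 gt_eqF.
by rewrite -[X in _ = _ + X]cE; ring.
Qed.

Let c_ge0 : 0 <= c.
Proof. by rewrite divr_ge0// mulr_ge0 ?ltW// (lt_trans ltr01). Qed.

Let c_le : c <= q / tau.
Proof.
rewrite /c invfM mulrA ler_piMr ?divr_ge0 ?(ltW tau0)//.
by rewrite invf_le1 ?(ltW lam1)// (lt_trans ltr01).
Qed.

(** The mean energy is a convex combination of [e0] and of the fixed point [c], so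
    it is at most [e0 + c], and [c] is at most [q / tau] because [lam > 1]. *)
Lemma mean_energy_le n : mean_energy tau lam q e0 n <= e0 + q / tau.
Proof.
apply: le_trans (lerD (lexx e0) c_le); rewrite mean_energyE.
have rn0 : 0 <= r ^+ n by rewrite exprn_ge0// ltW.
have rn1 : r ^+ n <= 1 by rewrite exprn_ile1// ltW.
have := mulr_ge0 rn0 c_ge0.
have := mulr_ge0 (_ : 0 <= 1 - r ^+ n) e00; rewrite subr_ge0 => /(_ rn1).
by nra.
Qed.

(** Noise gives the fixed point, which has weight less than one, a strict defect;
    initial energy is strictly damped from the first step on. *)
Lemma mean_energy_lt n : 0 < q \/ (0 < n)%N /\ 0 < e0 ->
  mean_energy tau lam q e0 n < e0 + q / tau.
Proof.
move=> H; apply: lt_le_trans (lerD (lexx e0) c_le); rewrite mean_energyE.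
have rn0 : 0 < r ^+ n by rewrite exprn_gt0.
have rn1 : r ^+ n <= 1 by rewrite exprn_ile1// ltW.
case: H => [qp|[n0 ep]].
  have cp : 0 < c by rewrite divr_gt0// mulr_gt0// (lt_trans ltr01).
  have := mulr_gt0 rn0 cp.
  have := mulr_ge0 (_ : 0 <= 1 - r ^+ n) e00; rewrite subr_ge0 => /(_ rn1).
  by nra.
have rnlt1 : r ^+ n < 1 by rewrite exprn_ilt1 ?(ltW r_gt0)// -lt0n.
have := mulr_ge0 (ltW rn0) c_ge0.
have := mulr_gt0 (_ : 0 < 1 - r ^+ n) ep; rewrite subr_gt0 => /(_ rnlt1).
by nra.
Qed.

Lemma cvg_mean_energy_rate :
  mean_energy tau lam q e0 n * (n%:R * tau)^-1 @[n --> \oo] --> (0 : R).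
Proof.
have h : (fun n => (e0 + q / tau) * (n%:R * tau)^-1) @ \oo --> (0 : R).
  exact: cvg_inv_time.
apply: (squeeze_cvgr _ (cvg_cst 0) h); apply: nearW => n.
have e_ge0 : 0 <= mean_energy tau lam q e0 n.
  elim: n => // n IH; rewrite /mean_energy iterS divr_ge0//.
    by rewrite addr_ge0// mulr_ge0// ltW.
  by rewrite addr_ge0// ltW.
have n_ge0 : 0 <= (n%:R * tau)^-1 by rewrite invr_ge0 mulr_ge0// ltW.
by rewrite mulr_ge0//= ler_wpM2r// mean_energy_le.
Qed.

End mean_energy_sequence.

Lemma cvg_mean_energy0_rate {R : realType} (tau q e0 : R) : 0 < tau ->
  mean_energy tau 0 q e0 n * (n%:R * tau)^-1 @[n --> \oo] --> q.
Proof.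
move=> tau0.
have h : (fun n => e0 * (n%:R * tau)^-1 + q) @ \oo --> q.
  rewrite -[X in _ --> X]add0r; apply: cvgD; last exact: cvg_cst.
  exact: cvg_inv_time.
apply: cvg_trans h; apply: near_eq_cvg; near=> n.
have n0 : n%:R * tau != 0.
  rewrite mulf_neq0 ?(gt_eqF tau0)// pnatr_eq0 -lt0n.
  by near: n; exact: nbhs_infty_gt.
by rewrite mean_energy0 mulrDl -mulrA mulrCA divff ?mulr1.
Unshelve. all: by end_near. Qed.

(** * One mode driven by orthogonal noise *)

Section random_oscillator.
Context {R : realType} {d : measure_display} {Omega : measurableType d}.
Variables (P : probability Omega R) (F : R -> set (set Omega)).
Hypothesis hF : complete_filtration P F.

Lemma adapted_le s t (X : Omega -> R) : 0 <= s -> s <= t ->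
  adapted (F s) X -> adapted (F t) X.
Proof. by move=> s0 st aX B mB; apply: (filtration_le hF s0 st); exact: aX. Qed.

Lemma adapted_random t (X : Omega -> R) : 0 <= t -> adapted (F t) X ->
  measurable_fun setT X.
Proof. by move=> t0; apply: adapted_measurable; exact: (filtration_sub hF). Qed.

Definition mode_energy (lam : R) (a b : R) : R := b ^+ 2 + lam * a ^+ 2.

Lemma mode_energy_ge0 lam a b : 0 <= lam -> 0 <= mode_energy lam a b.
Proof. by move=> lam0; rewrite addr_ge0 ?sqr_ge0// mulr_ge0// sqr_ge0. Qed.

Variables (tau lam q m : R) (a b xi : nat -> Omega -> R).
Hypotheses (tau0 : 0 < tau) (lam0 : 0 <= lam).
Let t (n : nat) : R := n%:R * tau.

Hypothesis a0_adapted : adapted (F 0) (a 0%N).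
Hypothesis b0_adapted : adapted (F 0) (b 0%N).
Hypothesis mean0 : has_mean P (fun w => mode_energy lam (a 0%N w) (b 0%N w)) m.
Hypothesis stepa : forall n w, a n.+1 w = a n w + tau * b n.+1 w.
Hypothesis stepb : forall n w,
  b n.+1 w = b n w - tau * lam * a n.+1 w + xi n w.
Hypothesis xi_adapted : forall n, adapted (F (t n.+1)) (xi n).
Hypothesis xi_sqr : forall n, has_mean P (fun w => xi n w ^+ 2) (tau * q).
Hypothesis xi_orth : forall n X, adapted (F (t n)) X -> sqr_integrable P X ->
  has_mean P (fun w => X w * xi n w) 0.

Let r := (1 + tau ^+ 2 * lam)^-1.

Let d_neq0 : 1 + tau ^+ 2 * lam != 0.
Proof. by rewrite gt_eqF// ltr_pwDl// mulr_ge0// sqr_ge0. Qed.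

Let t_ge0 n : 0 <= t n.
Proof. by rewrite mulr_ge0// ltW. Qed.

Let t_leS n : t n <= t n.+1.
Proof. by rewrite ler_wpM2r ?ler_nat// ltW. Qed.

(** The implicit scheme solved for the new state. *)
Lemma explicit_stepb n w :
  b n.+1 w = r * b n w + (- (r * tau * lam)) * a n w + r * xi n w.
Proof.
have Hb : b n.+1 w * (1 + tau ^+ 2 * lam) = b n w - tau * lam * a n w + xi n w.
  by move: (stepb n w); rewrite stepa => H; rewrite mulrDr mulr1 {1}H; ring.
by rewrite -[LHS](mulfK d_neq0) Hb -/r; ring.
Qed.

(** The damping of the backward step: it divides by
    [1 + tau ^ 2 lam], so modes with [lam > 0] forget past noise, and only the
    constant mode [lam = 0] accumulates it. *)
Lemma mode_energy_step n w : mode_energy lam (a n.+1 w) (b n.+1 w) =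
  r * (mode_energy lam (a n w) (b n w) + (2 * (b n w * xi n w) + xi n w ^+ 2)).
Proof. by rewrite /mode_energy stepa explicit_stepb /r; field. Qed.

(** The state after [n] steps only involves the noise up to time [n tau], so the
    next increment is independent of it. *)
Lemma state_adapted n : adapted (F (t n)) (a n) /\ adapted (F (t n)) (b n).
Proof.
elim: n => [|n [aa ab]]; first by rewrite /t mul0r.
have sF : sigma_algebra setT (F (t n.+1)) by exact: (filtration_sigma hF).
have aa' := adapted_le (t_ge0 n) (t_leS n) aa.
have ab' := adapted_le (t_ge0 n) (t_leS n) ab.
have abS : adapted (F (t n.+1)) (b n.+1).
  rewrite (_ : b n.+1 = fun w =>
      1 * (r * b n w + - (r * tau * lam) * a n w) + r * xi n w); last first.
    by apply/funext => w; rewrite explicit_stepb mul1r.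
  apply: adapted_lincomb => //; exact: adapted_lincomb.
split=> //; rewrite (_ : a n.+1 = fun w => 1 * a n w + tau * b n.+1 w).
  exact: adapted_lincomb.
by apply/funext => w; rewrite stepa mul1r.
Qed.

(** The induction carries the integrability of the energy, which dominates [b ^ 2]
    and so makes [b] an admissible partner of the noise; the position [a] cannot
    be used in this way, since for [lam = 0] it may have no moments. *)
Lemma mode_energy_mean n :
  has_mean P (fun w => mode_energy lam (a n w) (b n w))
    (mean_energy tau lam q m n).
Proof.
elim: n => // n IH; have [aa ab] := state_adapted n.
have ib : sqr_integrable P (b n).
  have mb := adapted_random (t_ge0 n) ab.
  apply: le_integrable IH.1 => //.
    by apply/measurable_EFinP; exact: measurable_funX.
  move=> w _ /=; rewrite lee_fin !ger0_norm ?sqr_ge0 ?mode_energy_ge0//.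
  by rewrite lerDl mulr_ge0// sqr_ge0.
have := has_meanD (has_meanZ 2 (xi_orth ab ib)) (xi_sqr n).
move=> /(has_meanD IH) /(has_meanZ r).
rewrite mulr0 add0r [r * _]mulrC => H.
by under eq_fun do rewrite mode_energy_step.
Qed.

End random_oscillator.

(** * Coordinates of the Levy process *)

Section levy_coordinates.
Context {R : realType} {d : measure_display} {Omega : measurableType d}.
Variables (P : probability Omega R) (F : R -> set (set Omega)).
Variables (L : R -> Omega -> L2_sphere R) (Q : L2_sphere R -> L2_sphere R).
Hypotheses (hF : complete_filtration P F) (hL : levy_process P F L)
  (hL0 : mean_zero_process P L) (hQ : covariance_operator P L Q).
Variable h : L2_sphere R.
Hypothesis h1 : l2dot h h = 1.

Lemma l2measurable_l2dot G (X : Omega -> L2_sphere R) :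
  l2measurable G X -> adapted G (fun w => l2dot (X w) h).
Proof. by move=> mX B mB; exact: (mX _ (l2borel_l2dot h1 mB)). Qed.

Lemma levy_coord_adapted t : 0 <= t -> adapted (F t) (fun w => l2dot (L t w) h).
Proof. by move=> t0; apply: l2measurable_l2dot; exact: (levy_adapted hL). Qed.

(** The covariance formula makes the integral of the nonnegative square finite,
    which is integrability. *)
Lemma levy_coord_sqr t : 0 <= t ->
  has_mean P (fun w => l2dot (L t w) h ^+ 2) (t * l2dot (Q h) h).
Proof.
move=> t0; have EL := covariance_eq hQ h h t0; rewrite unlock in EL.
have mL := adapted_random hF t0 (levy_coord_adapted t0).
have {}EL : (\int[P]_w (l2dot (L t w) h ^+ 2)%:E = (t * l2dot (Q h) h)%:E)%E.
  by under eq_integral do rewrite expr2.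
split => //; apply/integrableP; split.
  by apply/measurable_EFinP; exact: measurable_funX.
rewrite (eq_integral (fun w => (l2dot (L t w) h ^+ 2)%:E)) ?EL ?ltry// => w _.
by rewrite /= ger0_norm ?sqr_ge0.
Qed.

Lemma incr_coord s t w :
  l2dot (incr L s t w) h = l2dot (L t w) h - l2dot (L s w) h.
Proof. exact: l2dotBl. Qed.

Lemma incr_adapted s t : 0 <= s -> s <= t ->
  adapted (F t) (fun w => l2dot (incr L s t w) h).
Proof.
move=> s0 st; have t0 := le_trans s0 st.
rewrite (_ : (fun _ => _) = fun w =>
    1 * l2dot (L t w) h + -1 * l2dot (L s w) h).
  apply: adapted_lincomb; [exact: (filtration_sigma hF)| |].
    exact: levy_coord_adapted.
  by apply: (adapted_le hF s0 st); exact: levy_coord_adapted.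
by apply/funext => w; rewrite incr_coord mul1r mulN1r.
Qed.

Lemma incr_sqr_integrable s t : 0 <= s -> s <= t ->
  sqr_integrable P (fun w => l2dot (incr L s t w) h).
Proof.
move=> s0 st; have t0 := le_trans s0 st.
have iD := has_meanD (has_meanZ 2 (levy_coord_sqr t0))
  (has_meanZ 2 (levy_coord_sqr s0)).
have mi := adapted_random hF t0 (incr_adapted s0 st).
apply: le_integrable iD.1 => //.
  by apply/measurable_EFinP; exact: measurable_funX.
move=> w _ /=; rewrite lee_fin incr_coord !ger0_norm ?sqr_ge0//; last first.
  by rewrite addr_ge0// mulr_ge0// sqr_ge0.
by have := sqr_ge0 (l2dot (L t w) h + l2dot (L s w) h); nra.
Qed.

Lemma levy_coord_integral t : 0 <= t -> (\int[P]_w (l2dot (L t w) h)%:E = 0)%E.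
Proof. by move=> t0; have := hL0 h t0; rewrite unlock. Qed.

Lemma incr_orthogonal s t X : 0 <= s -> s <= t ->
  adapted (F s) X -> sqr_integrable P X ->
  has_mean P (fun w => X w * l2dot (incr L s t w) h) 0.
Proof.
move=> s0 st aX iX; have t0 := le_trans s0 st.
have mX := adapted_random hF s0 aX.
have mi := adapted_random hF t0 (incr_adapted s0 st).
have ii := incr_sqr_integrable s0 st.
split; first exact: integrableM.
apply: independent_expectationM0 => //.
  move=> A B mA mB.
  exact: (levy_independent hL s0 st (aX _ mA) (l2borel_l2dot h1 mB)).
have iL u : 0 <= u -> P.-integrable setT (EFin \o (fun w => l2dot (L u w) h)).
  move=> u0; apply: sqr_integrable_integrable.
    exact: (adapted_random hF u0 (levy_coord_adapted u0)).
  exact: (levy_coord_sqr u0).1.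
under eq_integral do rewrite incr_coord EFinB.
by rewrite integralB_EFin ?levy_coord_integral ?sube0//; exact: iL.
Qed.

(** Expand [L_t ^ 2 = (L_s + increment) ^ 2]; the cross term has mean zero by
    independence, so only the difference of the two variances remains. *)
Lemma incr_sqr s t : 0 <= s -> s <= t ->
  has_mean P (fun w => l2dot (incr L s t w) h ^+ 2) ((t - s) * l2dot (Q h) h).
Proof.
move=> s0 st; have t0 := le_trans s0 st.
have O := incr_orthogonal s0 st (levy_coord_adapted s0) (levy_coord_sqr s0).1.
have := has_meanD (has_meanD (levy_coord_sqr t0)
  (has_meanZ (-1) (levy_coord_sqr s0))) (has_meanZ (-2) O).
rewrite (_ : _ + -2 * 0 = (t - s) * l2dot (Q h) h); last by ring.
congr has_mean; apply/funext => w; rewrite incr_coord; ring.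
Qed.

End levy_coordinates.

(** * Summing the modes *)

Definition mode0 : nat * int := (0%N, 0).

Lemma mode0_in kappa : mode0 \in modes kappa.
Proof. by rewrite mem_modes. Qed.

Lemma modes_cases (R : realType) kappa i : i \in modes kappa ->
  i = mode0 \/ i != mode0 /\ 1 < lambda i.1 :> R.
Proof.
case: i => l m; rewrite mem_modes => /andP[_].
case: l => [|l] im; last by right; split; [|exact: lambda_gt1].
by left; move: im; rewrite mem_seq1 => /eqP /= ->.
Qed.

Section total_energy.
Context {R : realType}.
Variables (tau : R) (kappa : nat) (q m : nat * int -> R).
Hypothesis tau0 : 0 < tau.
Hypothesis q_ge0 : forall i, i \in modes kappa -> 0 <= q i.
Hypothesis m_ge0 : forall i, i \in modes kappa -> 0 <= m i.

Let e i n := mean_energy tau (lambda i.1) (q i) (m i) n.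

(* The indicator singles out the only mode whose energy grows with [n]. *)
Let mode_bound i n := m i + q i / tau + (i == mode0)%:R * (n%:R * tau * q i).

Let mode_le i n : i \in modes kappa -> e i n <= mode_bound i n.
Proof.
move=> ik; rewrite /mode_bound; have [->|[/negbTE-> lam1]] := modes_cases R ik.
  have := divr_ge0 (q_ge0 (mode0_in kappa)) (ltW tau0).
  by rewrite /e lambda0 mean_energy0 eqxx mul1r; lra.
by rewrite mul0r addr0; exact: (mean_energy_le tau0 (q_ge0 ik) (m_ge0 ik)).
Qed.

Let mode_lt i n : i \in modes kappa ->
  0 < q i \/ (0 < n)%N /\ i != mode0 /\ 0 < m i -> e i n < mode_bound i n.
Proof.
move=> ik H; rewrite /mode_bound; have [i0|[i0 lam1]] := modes_cases R ik.
  case: H => [qp|[_ []]]; last by rewrite i0 eqxx.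
  have := divr_gt0 qp tau0; rewrite i0 in qp *.
  by rewrite /e lambda0 mean_energy0 eqxx mul1r; lra.
rewrite (negbTE i0) mul0r addr0.
apply: (mean_energy_lt tau0 (q_ge0 ik) (m_ge0 ik)) => //.
by case: H => [?|[? [_ ?]]]; [left|right].
Qed.

Let sum_bound n : 2^-1 * (\sum_(i <- modes kappa) mode_bound i n)
  = 2^-1 * (\sum_(i <- modes kappa) m i)
    + (2 * tau)^-1 * (\sum_(i <- modes kappa) q i) + n%:R * tau / 2 * q mode0.
Proof.
rewrite /mode_bound !big_split/= -mulr_suml.
rewrite [X in _ * (_ + X)](bigD1_seq mode0 (mode0_in _) (uniq_modes _))/=.
rewrite [X in _ * (_ + (_ + X))]big1 => [|i /negbTE->]; last by rewrite mul0r.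
by rewrite mul1r; field; rewrite gt_eqF.
Qed.

Lemma total_energy_le n :
  2^-1 * (\sum_(i <- modes kappa) e i n)
  <= 2^-1 * (\sum_(i <- modes kappa) m i)
    + (2 * tau)^-1 * (\sum_(i <- modes kappa) q i) + n%:R * tau / 2 * q mode0.
Proof.
rewrite -sum_bound ler_pM2l// [leLHS]big_seq [leRHS]big_seq.
by apply: ler_sum => i; exact: mode_le.
Qed.

(** One strict mode makes the sum strict. A positive trace yields a noisy mode; a
    mean energy exceeding that of the constant mode yields a damped mode that is
    excited at time [0]. *)
Lemma total_energy_lt n :
  0 < \sum_(i <- modes kappa) q i \/
  (0 < n)%N /\ m mode0 < \sum_(i <- modes kappa) m i ->
  2^-1 * (\sum_(i <- modes kappa) e i n)
  < 2^-1 * (\sum_(i <- modes kappa) m i)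
    + (2 * tau)^-1 * (\sum_(i <- modes kappa) q i) + n%:R * tau / 2 * q mode0.
Proof.
have pos_term (s : seq (nat * int)) (f : nat * int -> R) :
    0 < \sum_(i <- s) f i -> exists2 i, i \in s & 0 < f i.
  move=> f0; apply/hasP; apply: contraLR f0.
  rewrite -all_predC -leNgt => /allP f0.
  by rewrite big_seq; apply: sumr_le0 => i /f0; rewrite /= -leNgt.
move=> H; rewrite -sum_bound ltr_pM2l//.
suff [i ik Hi] : exists2 i, i \in modes kappa & e i n < mode_bound i n.
  rewrite !(bigD1_seq i ik (uniq_modes kappa))/=; apply: ltr_leD => //.
  rewrite big_seq_cond [leRHS]big_seq_cond; apply: ler_sum => j /andP[jk _].
  exact: mode_le.
case: H => [/pos_term[i ik qi]|[n0]].
  by exists i => //; apply: mode_lt => //; left.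
rewrite (bigD1_seq mode0 (mode0_in kappa) (uniq_modes kappa))/= ltrDl.
rewrite -big_filter => /pos_term[i]; rewrite mem_filter => /andP[i0 ik] mi.
by exists i => //; apply: mode_lt => //; right.
Qed.

Lemma cvg_total_energy :
  2^-1 * (\sum_(i <- modes kappa) e i n) * (n%:R * tau)^-1 @[n --> \oo]
  --> 2^-1 * q mode0.
Proof.
under eq_fun do rewrite -mulrA mulr_suml.
apply: cvgMl_tmp.
have -> : q mode0 = \sum_(i <- modes kappa) (i == mode0)%:R * q i.
  rewrite (bigD1_seq mode0 (mode0_in kappa) (uniq_modes kappa))/= mul1r.
  by rewrite big1 ?addr0// => i /negbTE->; rewrite mul0r.
suff cvg_seq (s : seq (nat * int)) : {subset s <= modes kappa} ->
    \sum_(i <- s) e i n * (n%:R * tau)^-1 @[n --> \oo]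
    --> \sum_(i <- s) (i == mode0)%:R * q i.
  exact: cvg_seq.
elim: s => [_|i s IH sk].
  by rewrite big_nil; under eq_fun do rewrite big_nil; exact: cvg_cst.
rewrite big_cons; under eq_fun do rewrite big_cons.
apply: cvgD; last by apply: IH => j js; apply: sk; rewrite inE js orbT.
have ik : i \in modes kappa by apply: sk; rewrite mem_head.
have [->|[/negbTE-> lam1]] := modes_cases R ik.
  by rewrite eqxx mul1r /e lambda0; exact: cvg_mean_energy0_rate.
by rewrite mul0r; exact: (cvg_mean_energy_rate tau0 (q_ge0 ik) (m_ge0 ik)).
Qed.

End total_energy.

(** * Coordinates of the scheme *)

Section scheme.
Context {R : realType} {d : measure_display} {Omega : measurableType d}.
Variables (Y : nat -> int -> L2_sphere R) (L : R -> Omega -> L2_sphere R)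
  (v1 v2 : Omega -> L2_sphere R) (kappa : nat) (tau : R)
  (u1 u2 : nat -> Omega -> L2_sphere R).
Hypotheses (hY : spherical_harmonic_basis Y)
  (hu : backward_euler_maruyama Y L v1 v2 kappa tau u1 u2).
Local Notation coef := (coef Y).
Local Notation synth := (synth Y kappa).

Let step2 n w : l2eq (u2 n.+1 w) (u2 n w
  + tau *: synth (fun i => - (lambda i.1 * coef (u1 n.+1 w) i))
  + synth (coef (incr L (n%:R * tau) (n.+1%:R * tau) w))).
Proof.
have := bem_step2 hu n w; rewrite (disc_laplacianE hY) projE.
exact.
Qed.

Lemma scheme_coef_init1 w i : i \in modes kappa ->
  coef (u1 0 w) i = coef (v1 w) i.
Proof. by move=> ik; rewrite (coef_l2eq Y i (bem_init1 hu w)) coef_proj. Qed.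

Lemma scheme_coef_init2 w i : i \in modes kappa ->
  coef (u2 0 w) i = coef (v2 w) i.
Proof. by move=> ik; rewrite (coef_l2eq Y i (bem_init2 hu w)) coef_proj. Qed.

Lemma scheme_coef1 n w i :
  coef (u1 n.+1 w) i = coef (u1 n w) i + tau * coef (u2 n.+1 w) i.
Proof.
have step1 : l2eq (u1 n.+1 w) (u1 n w + tau *: u2 n.+1 w).
  exact (bem_step1 hu n w).
by rewrite (coef_l2eq Y i step1) coef_add coef_scale.
Qed.

Lemma scheme_coef2 n w i : i \in modes kappa -> coef (u2 n.+1 w) i
  = coef (u2 n w) i - tau * lambda i.1 * coef (u1 n.+1 w) i
    + coef (incr L (n%:R * tau) (n.+1%:R * tau) w) i.
Proof.
move=> ik; rewrite (coef_l2eq Y i (step2 n w)) 2![in LHS]coef_add coef_scale.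
by rewrite !coef_synth_in// mulrN mulrA.
Qed.

(** The velocity never leaves the span of the retained harmonics, up to null
    sets, so its norm is given by its coordinates. *)
Lemma scheme_span n w : l2eq (u2 n w) (synth (coef (u2 n w))).
Proof.
suff [c uc] : exists c, l2eq (u2 n w) (synth c) by rewrite (synth_coef hY uc).
elim: n => [|n [c uc]].
  by exists (coef (v2 w)); rewrite -projE; exact: (bem_init2 hu w).
pose lap i := - (lambda i.1 * coef (u1 n.+1 w) i).
pose noise := coef (incr L (n%:R * tau) (n.+1%:R * tau) w).
exists (fun i => 1 * (tau * lap i + c i) + noise i).
rewrite !synth_lincomb scale1r [X in X + _]addrC.
apply: filterS2 uc (step2 n w) => p /(_ I) uc /(_ I) step _.
by rewrite step; congr (_ + _ + _).
Qed.

Lemma disc_energyE n w : disc_energy Y kappa (u1 n w) (u2 n w)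
  = 2^-1 * \sum_(i <- modes kappa)
      mode_energy (lambda i.1) (coef (u1 n w) i) (coef (u2 n w) i).
Proof.
rewrite /disc_energy (sqr_l2norm_l2eq (scheme_span n w)) disc_half_laplacianE.
rewrite !sqr_l2norm_synth// -big_split/=; congr (_ * _); apply: eq_bigr => i _.
by rewrite /mode_energy exprMn sqr_sqrtr ?lambda_ge0.
Qed.

End scheme.

(** * Initial energy *)

Section initial_energy.
Context {R : realType}.
Variable Y : nat -> int -> L2_sphere R.
Hypothesis hY : spherical_harmonic_basis Y.

(** Bessel for the velocity; for the position, one term of the series defining the
    square norm of the half Laplacian. *)
Lemma mode_energy_le_energy (f g : L2_sphere R) i : i.2 \in orders i.1 ->
  ((2^-1 * mode_energy (lambda i.1) (coef Y f i) (coef Y g i))%:E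
   <= energy Y f g)%E.
Proof.
move=> im; rewrite /energy EFinM; apply: lee_wpmul2l; first by rewrite lee_fin.
rewrite /mode_energy EFinD; apply: leeD.
  by rewrite lee_fin sqr_l2norm l2dot_sqr_le// l2dot_harmonic.
have term_ge0 l m : 0 <= lambda l * l2dot f (Y l m) ^+ 2.
  by rewrite mulr_ge0 ?lambda_ge0// sqr_ge0.
have series_ge0 l :
    (0 <= (\sum_(m <- orders l) lambda l * l2dot f (Y l m) ^+ 2)%R%:E)%E.
  by rewrite lee_fin sumr_ge0.
apply: le_trans (nneseries_lim_ge i.1.+1 (fun l _ _ => series_ge0 l)).
rewrite big_nat_recr//=; apply: le_trans (leeDr _ (sume_ge0 _ _)); last first.
  by move=> l _; exact: series_ge0.
rewrite lee_fin (bigD1_seq i.2 im (uniq_orders _))/= lerDl.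
by rewrite sumr_ge0.
Qed.

Context {d : measure_display} {Omega : measurableType d}.
Variables (P : probability Omega R) (F : R -> set (set Omega)).
Hypothesis hF : complete_filtration P F.

Lemma initial_mode_energy_integrable (v1 v2 : Omega -> L2_sphere R) i :
  l2measurable (F 0) v1 -> l2measurable (F 0) v2 ->
  (\int[P]_w energy Y (v1 w) (v2 w) < +oo)%E -> i.2 \in orders i.1 ->
  P.-integrable setT (EFin \o (fun w =>
    mode_energy (lambda i.1) (coef Y (v1 w) i) (coef Y (v2 w) i))).
Proof.
move=> mv1 mv2 hE im; set e := fun w => mode_energy _ _ _.
have h1 := l2dot_harmonic hY im.
have mX v : l2measurable (F 0) v ->
    measurable_fun setT (fun w => coef Y (v w) i).
  by move=> mv; exact: (adapted_random hF (lexx 0) (l2measurable_l2dot h1 mv)).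
have me : measurable_fun setT e.
  by apply: measurable_funD; [|apply: measurable_funM => //];
    apply: measurable_funX; exact: mX.
have e_ge0 w : 0 <= e w by exact: mode_energy_ge0 (lambda_ge0 _ _).
have h_int : P.-integrable setT (EFin \o (fun w => 2^-1 * e w)).
  apply/integrableP; split.
    by apply/measurable_EFinP; exact: measurable_funM.
  apply: le_lt_trans hE; apply: le_integral_ge0 => w; first by rewrite abse_ge0.
  rewrite /= ger0_norm ?mulr_ge0//; exact: mode_energy_le_energy.
have := integrableZl measurableT 2 h_int; congr (_.-integrable _ _).
by apply/funext => w /=; rewrite -EFinM mulrA divff// mul1r.
Qed.

End initial_energy.

(** * Energy growth of the scheme *)

Unset Implicit Arguments.

Theorem proposition6 (R : realType)
    (d : measure_display) (Omega : measurableType d) (P : probability Omega R)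
    (F : R -> set (set Omega))
    (Y : nat -> int -> L2_sphere R)
    (Q : L2_sphere R -> L2_sphere R) (L : R -> Omega -> L2_sphere R)
    (v1 v2 : Omega -> L2_sphere R)
    (kappa : nat) (tau : R)
    (u1 u2 : nat -> Omega -> L2_sphere R)
    (hF : complete_filtration P F)
    (hY : spherical_harmonic_basis Y)
    (hL : levy_process P F L)
    (hL2 : square_integrable_process P L)
    (hL0 : mean_zero_process P L)
    (hQ : covariance_operator P L Q)
    (hTr : (trace Y Q < +oo)%E)
    (hv1 : l2measurable (F 0) v1) (hv2 : l2measurable (F 0) v2)
    (hE : (\int[P]_w energy Y (v1 w) (v2 w) < +oo)%E)
    (hkappa : (0 < kappa)%N) (htau : 0 < tau)
    (hu : backward_euler_maruyama Y L v1 v2 kappa tau u1 u2)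
    (hE0 : (0 < 'E_P[fun w => disc_energy Y kappa (u1 0%N w) (u2 0%N w)])%E) :
  let E n := 'E_P[fun w => disc_energy Y kappa (u1 n w) (u2 n w)]%E in
  let E00 := 'E_P[(fun w => 2^-1 * l2dot (v2 w) (Y 0%N 0) ^+ 2)%R]%E in
  let TrQ := trace Y (disc_operator Y kappa Q) in
  let v00 := variance P (fun w => l2dot (L 1 w) (Y 0%N 0)) in
  let bound n := (E 0%N + ((2 * tau)^-1)%:E * TrQ
                  + (n%:R * tau / 2)%:E * v00)%E in
  (forall n : nat,
     (E n <= bound n)%E /\
     ((0 < TrQ)%E \/ (0 < n)%N /\ (E00 < E 0%N)%E -> (E n < bound n)%E)) /\
  ((E n * ((n%:R * tau)^-1)%:E)%E @[n --> \oo] --> ((2^-1)%:E * v00)%E).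
Proof.
move=> E E00 TrQ v00 bound.
pose q i := coef Y (Q (Y i.1 i.2)) i.
pose m i := fine (\int[P]_w
  (mode_energy (lambda i.1) (coef Y (v1 w) i) (coef Y (v2 w) i))%:E).
have im i : i \in modes kappa -> i.2 \in orders i.1.
  by rewrite mem_modes => /andP[].
have q_ge0 i : i \in modes kappa -> 0 <= q i.
  by move=> _; exact: (covariance_psd hQ).
have m_ge0 i : i \in modes kappa -> 0 <= m i.
  move=> _; apply: fine_ge0; apply: integral_ge0 => w _.
  by rewrite lee_fin mode_energy_ge0// lambda_ge0.
have mean0 i : i \in modes kappa -> has_mean P (fun w =>
    mode_energy (lambda i.1) (coef Y (v1 w) i) (coef Y (v2 w) i)) (m i).
  move=> /im ii.
  have ie := initial_mode_energy_integrable hY hF hv1 hv2 hE ii.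
  by split => //; rewrite fineK//; exact: integrable_fin_num ie.
have mode_mean n i : i \in modes kappa -> has_mean P (fun w =>
    mode_energy (lambda i.1) (coef Y (u1 n w) i) (coef Y (u2 n w) i))
    (mean_energy tau (lambda i.1) (q i) (m i) n).
  move=> ik; have h1 := l2dot_harmonic hY (im i ik).
  have t_ge0 k : 0 <= k%:R * tau by rewrite mulr_ge0// ltW.
  have t_le k : k%:R * tau <= k.+1%:R * tau by rewrite ler_wpM2r ?ler_nat// ltW.
  apply: (mode_energy_mean hF htau (lambda_ge0 R i.1)
    (a := fun n w => coef Y (u1 n w) i) (b := fun n w => coef Y (u2 n w) i)
    (xi := fun n w => coef Y (incr L (n%:R * tau) (n.+1%:R * tau) w) i)).
  - rewrite (_ : (fun w => coef Y (u1 0%N w) i) = fun w => coef Y (v1 w) i).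
      exact: l2measurable_l2dot.
    by apply/funext => w; rewrite (scheme_coef_init1 hY hu).
  - rewrite (_ : (fun w => coef Y (u2 0%N w) i) = fun w => coef Y (v2 w) i).
      exact: l2measurable_l2dot.
    by apply/funext => w; rewrite (scheme_coef_init2 hY hu).
  - under eq_fun do
      rewrite (scheme_coef_init1 hY hu)// (scheme_coef_init2 hY hu)//.
    exact: mean0.
  - by move=> k w; rewrite (scheme_coef1 hu).
  - by move=> k w; rewrite (scheme_coef2 hY hu).
  - by move=> k; exact: (incr_adapted hF hL h1 (t_ge0 k) (t_le k)).
  - move=> k; have := incr_sqr hF hL hL0 hQ h1 (t_ge0 k) (t_le k).
    by rewrite -mulrBl -natr1 addrAC subrr add0r mul1r.
  - move=> k X aX iX.
    exact: (incr_orthogonal hF hL hL0 hQ h1 (t_ge0 k) (t_le k) aX iX).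
have EE n : E n = (2^-1 * \sum_(i <- modes kappa)
    mean_energy tau (lambda i.1) (q i) (m i) n)%:E.
  apply: has_mean_expectation; under eq_fun do rewrite (disc_energyE hY hu).
  by apply/has_meanZ/has_mean_sum; exact: mode_mean.
have TrQE : TrQ = (\sum_(i <- modes kappa) q i)%:E.
  exact: (trace_disc_operator hY kappa (covariance_sym hQ) (covariance_psd hQ)).
have v00E : v00 = (q mode0)%:E.
  rewrite /v00 /variance unlock (hL0 1 (Y 0%N 0) ler01)/=.
  rewrite -[RHS]mul1e -[X in (X * _)%E]/(1%:E) -EFinM.
  rewrite -(covariance_eq hQ _ _ ler01).
  congr ('E_P[_])%E; apply/funext => w /=.
  by rewrite /GRing.mul/= !subr0.
have E00E : E00 = (2^-1 * m mode0)%:E.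
  apply: has_mean_expectation; apply: has_meanZ.
  have := mean0 _ (mode0_in kappa); congr has_mean; apply/funext => w.
  by rewrite /mode_energy lambda0 mul0r addr0.
have boundE n : bound n = (2^-1 * (\sum_(i <- modes kappa) m i)
    + (2 * tau)^-1 * (\sum_(i <- modes kappa) q i)
    + n%:R * tau / 2 * q mode0)%:E.
  by rewrite /bound EE TrQE v00E -!EFinM -!EFinD.
split.
  move=> n; rewrite EE boundE TrQE E00E EE lee_fin !lte_fin ltr_pM2l//.
  split; first exact: total_energy_le.
  exact: total_energy_lt.
under eq_fun do rewrite EE -EFinM.
rewrite v00E -EFinM; apply: cvg_EFin; first exact: nearW.
exact: cvg_total_energy.
Qed.
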